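(* Let $\lambda$ be a cardinal with $\lambda<\mathfrak h$. Then every sequentially compact topological space $X$ is $\lambda$-ssc.
   Context: $[\omega]^\omega$ is the set of all infinite subsets of $\omega$. A sequence $x=\langle x_n:n<\omega\rangle$ converges along $H\in[\omega]^\omega$ if the subsequence $\langle x_n:n\in H\rangle$ converges. A space $X$ is $\lambda$-simultaneously sequentially compact ($\lambda$-ssc) if for any $\lambda$-many sequences with values in $X$ there is $H\in[\omega]^\omega$ such that each of those sequences converges along $H$. No separation axioms are assumed. A set $\mathcal A\subseteq[\omega]^\omega$ is open if $H\in\mathcal A$, $H'\in[\omega]^\omega$ and $H'\subseteq H$ imply $H'\in\mathcal A$. A set $\mathcal D\subseteq[\omega]^\omega$ is dense if for every $H\in[\omega]^\omega$ there is $H'\in\mathcal D$ with $H'\subseteq H$. The distributivity number $\mathfrak h$ is the least cardinality of a family of dense open subsets of $[\omega]^\omega$ having empty intersection. *)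

(* Defs.v *)
From HB Require Import structures.
From mathcomp Require Import all_boot all_order.
From mathcomp Require Import all_classical all_reals all_analysis.

Set Implicit Arguments.
Unset Strict Implicit.
Unset Printing Implicit Defensive.

Local Open Scope classical_set_scope.
Local Open Scope card_scope.

(* Limits are always stated as [exists l, _ --> l]: no separation axiom and no
   base point are assumed, so limits need not be unique and X may be empty. *)
Definition converges (X : topologicalType) (x : nat -> X) : Prop :=
  exists l : X, x n @[n --> \oo] --> l.

(* The subsequence <x_n : n in H> is x composed with the increasing
   enumeration k of the infinite set H. *)
Definition converges_along (X : topologicalType) (x : nat -> X)
    (H : set nat) : Prop :=
  exists k : nat -> nat, [/\ increasing_seq k, range k = H & converges (x \o k)].

Definition sequentially_compact (X : topologicalType) : Prop :=
  forall x : nat -> X,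
    exists k : nat -> nat, increasing_seq k /\ converges (x \o k).

Definition simult_seq_compact (L : Type) (X : topologicalType) : Prop :=
  forall x : L -> nat -> X,
    exists H : set nat, infinite_set H /\ forall i : L, converges_along (x i) H.

Definition inf_subsets : set (set nat) := [set H | infinite_set H].

Definition almost_subset (H' H : set nat) : Prop := finite_set (H' `\` H).

(* Two conventions occur for "open": closure under infinite subsets
   ([le := subset]) and closure under infinite almost subsets
   ([le := almost_subset]).  They give different numbers: the sets
   [set H in inf_subsets | ~ H n], n in nat, are dense, are open for the first
   convention only, and have empty intersection; so the first convention yields
   a number that is at most aleph_0, and the second one yields the distributivity
   number of P(omega)/fin.  Hence the parameter [le]. *)
Definition open_family (le : set nat -> set nat -> Prop)
    (A : set (set nat)) : Prop :=
  A `<=` inf_subsets /\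
  forall H H', A H -> inf_subsets H' -> le H' H -> A H'.

Definition dense_family (D : set (set nat)) : Prop :=
  D `<=` inf_subsets /\
  forall H, inf_subsets H -> exists2 H', D H' & H' `<=` H.

(* The intersection is taken inside [inf_subsets], so that the intersection of
   the empty family is [inf_subsets]. *)
Definition dense_open_empty_meet (le : set nat -> set nat -> Prop)
    (F : set (set (set nat))) : Prop :=
  (forall A, F A -> open_family le A /\ dense_family A) /\
  inf_subsets `&` \bigcap_(A in F) A = set0.

(* The cardinal h is represented by a family h of least cardinality. *)
Definition distributivity_number (le : set nat -> set nat -> Prop)
    (h : set (set (set nat))) : Prop :=
  dense_open_empty_meet le h /\
  forall F, dense_open_empty_meet le F -> h #<= F.

Definition card_lt (T U : Type) (A : set T) (B : set U) : Prop :=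
  (A #<= B) /\ ~ (B #<= A).

(* Main.v *)
Require Import Defs.
From HB Require Import structures.
From mathcomp Require Import all_boot all_order.
From mathcomp Require Import all_classical all_reals all_analysis.

(** For a sequence [x] in a sequentially compact space, let [D x]
    ([convergence_sets x]) be the family of the infinite sets along which
    [x] converges. It is dense: inside an infinite set [H], apply
    sequential compactness to a subsequence of [x] whose indices lie in
    [H] ([convergence_sets_dense]). It is open, even for almost inclusion,
    because a limit along [H] depends only on the trace of the Frechet
    filter on [H] ([converges_alongE]), and the trace on an almost subset
    is finer ([convergence_sets_open]).

    Given sequences [x i], [i : L], the family of all [D (x i)] has
    cardinality at most that of [L]. If no infinite set belonged to every
    [D (x i)], this family would be a competitor in the definition of the
    distributivity number, which would then be at most the cardinality of
    [L], a contradiction. So some infinite [H] lies in every [D (x i)],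
    which is what simultaneous sequential compactness asks for. Both
    conventions for open families are instances of one argument
    ([simult_seq_compact_of_card_lt]), since inclusion and almost
    inclusion both imply almost inclusion. *)

Local Open Scope classical_set_scope.
Local Open Scope card_scope.

(** * Increasing enumerations of sets of natural numbers *)

Lemma increasing_seq_ge_id {k : nat -> nat} :
  increasing_seq k -> forall n, (n <= k n)%N.
Proof.
move=> /increasing_seqP kS; elim=> [//|n IH].
exact: leq_ltn_trans IH (kS n).
Qed.

Lemma infinite_range_increasing {k : nat -> nat} :
  increasing_seq k -> infinite_set (range k).
Proof.
move=> kinc; rewrite (eq_finite_set (inj_card_eq _)); first exact: infinite_nat.
by move=> a b _ _; exact: increasing_seq_injective.
Qed.

Lemma finite_set_near_notin {A : set nat} :
  finite_set A -> \forall n \near \oo, ~ A n.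
Proof.
move=> /finite_seqP[s ->]; exists (\max_(i <- s) i).+1 => // n /= lt_n sn.
by have := @leq_bigmax_seq _ s xpredT id n sn isT; rewrite leqNgt lt_n.
Qed.

(** Iterating the map that sends [m] to the least element of [H] that is at
    least [m] cannot skip an element of [H]. *)
Lemma infinite_set_enumeration {H : set nat} : infinite_set H ->
  exists k : nat -> nat, increasing_seq k /\ range k = H.
Proof.
move=> Hinf.
have Hge m : exists a, (m <= a)%N && `[< H a >].
  have [|f [_ fgt fH]] := infinite_increasing_seq_wf (A := H) _ Hinf m.
    by move=> b; apply: (sub_finite_set _ (finite_II b.+1)) => c /=.
  by exists (f 0); rewrite ltnW; [exact/asboolP|exact: fgt].
pose next m := ex_minn (Hge m).
have nextP m : [/\ (m <= next m)%N, H (next m) &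
    forall a, (m <= a)%N -> H a -> (next m <= a)%N].
  rewrite /next; case: ex_minnP => a /andP[ma /asboolP Ha] amin; split => // b mb Hb.
  by apply: amin; rewrite mb; exact/asboolP.
pose k := fix k n := if n is n'.+1 then next (k n').+1 else next 0.
have kinc : increasing_seq k.
  by apply/increasing_seqP => n /=; have [] := nextP (k n).+1.
exists k; split=> //; apply/seteqP; split=> [_ [n _ <-]|a Ha].
  by case: n => [|n] /=; [have [] := nextP 0 | have [] := nextP (k n).+1].
have below n : (a < k n)%N -> range k a.
  elim: n => [|n IH] /= alt.
    by have [_ _ /(_ a isT Ha)] := nextP 0; rewrite leqNgt alt.
  have [akn|kna|->] := ltngtP a (k n); [exact: IH| |by exists n].
  by have [_ _ /(_ a kna Ha)] := nextP (k n).+1; rewrite leqNgt alt.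
exact: (below a.+1 (increasing_seq_ge_id kinc a.+1)).
Qed.

(** * Convergence along an infinite set *)

Section ConvergenceSets.
Context {X : topologicalType}.
Implicit Types (x : nat -> X) (H : set nat).

(** An increasing sequence eventually exceeds any bound, and conversely the
    elements of its range beyond [k N] have index at least [N]. *)
Lemma cvg_increasing_seqE x (k : nat -> nat) (l : X) : increasing_seq k ->
  ((x \o k) n @[n --> \oo] --> l) <-> (x n @[n --> within (range k) \oo] --> l).
Proof.
move=> kinc; split=> cvx U /cvx [N _ NU].
- exists (k N) => // m /= kNm [n _ nE]; rewrite -{}nE -leEnat kinc in kNm *.
  exact: NU.
- exists N => // n /= Nn; apply: (NU (k n)); last by exists n.
  exact: leq_trans Nn (increasing_seq_ge_id kinc n).
Qed.

(** The trace of the Frechet filter on [H] expresses the limit along [H] without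
    mentioning an enumeration, so that limits along different sets can be
    compared. *)
Lemma converges_alongE x H : infinite_set H ->
  converges_along x H <-> exists l : X, x n @[n --> within H \oo] --> l.
Proof.
move=> Hinf; split=> [[k [kinc <- [l]]]|[l cvx]].
  by move=> /cvg_increasing_seqE-/(_ kinc); exists l.
have [k [kinc kH]] := infinite_set_enumeration Hinf.
by exists k; split=> //; exists l; apply/cvg_increasing_seqE; rewrite ?kH.
Qed.

Definition convergence_sets x : set (set nat) :=
  [set H | infinite_set H /\ converges_along x H].

Lemma convergence_sets_open (le : set nat -> set nat -> Prop) x :
  (forall H' H, le H' H -> almost_subset H' H) ->
  open_family le (convergence_sets x).
Proof.
move=> le_almost; split=> [H []//|H H' [Hinf xH] H'inf /le_almost H'H].
split=> //; move: xH; rewrite !converges_alongE// => -[l cvx].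
exists l => U /cvx UH.
have {}UH : \forall n \near \oo, H n -> U (x n) := UH.
suff : \forall n \near \oo, H' n -> U (x n) by [].
apply: filterS2 UH (finite_set_near_notin H'H) => n nUH nH'H H'n.
by apply: nUH; apply: contrapT => nHn; exact: nH'H.
Qed.

Lemma convergence_sets_dense x :
  sequentially_compact X -> dense_family (convergence_sets x).
Proof.
move=> Xsc; split=> [H []//|H Hinf].
have [|f [finc _ fH]] := infinite_increasing_seq_wf (A := H) _ Hinf 0.
  by move=> b; apply: (sub_finite_set _ (finite_II b.+1)) => c /=.
have [g [ginc cvx]] := Xsc (x \o f).
have fginc : increasing_seq (f \o g) by move=> a b /=; rewrite finc -leEnat ginc.
exists (range (f \o g)); last by move=> _ [n _ <-]; exact: fH.
by split; [exact: infinite_range_increasing | exists (f \o g)].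
Qed.

End ConvergenceSets.

(** * The distributivity number *)

Lemma simult_seq_compact_of_card_lt (le : set nat -> set nat -> Prop)
    (L : Type) (h : set (set (set nat))) (X : topologicalType) :
  (forall H' H, le H' H -> almost_subset H' H) ->
  distributivity_number le h -> card_lt [set: L] h ->
  sequentially_compact X -> simult_seq_compact L X.
Proof.
move=> le_almost [_ hmin] [_ hNleL] Xsc x.
pose F := range (convergence_sets \o x).
have [H [Hinf HF]] : (inf_subsets `&` \bigcap_(A in F) A) !=set0.
  apply/set0P/eqP => F0; apply: hNleL.
  apply: card_le_trans (card_image_le (convergence_sets \o x) _).
  apply: hmin; split=> // _ [i _ <-]; split.
    exact: convergence_sets_open.
  exact: convergence_sets_dense.
by exists H; split=> // i; have [] : convergence_sets (x i) H by apply: HF; exists i.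
Qed.

Theorem theorem5p2 (L : Type) :
  (forall h : set (set (set nat)),
     distributivity_number subset h -> card_lt [set: L] h ->
     forall X : topologicalType,
       sequentially_compact X -> simult_seq_compact L X) /\
  (forall h : set (set (set nat)),
     distributivity_number almost_subset h -> card_lt [set: L] h ->
     forall X : topologicalType,
       sequentially_compact X -> simult_seq_compact L X).
Proof.
split=> h hP Lh X; apply: simult_seq_compact_of_card_lt hP Lh => // H' H.
by rewrite -setD_eq0 /almost_subset => ->; exact: finite_set0.
Qed.
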